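(* Let $\mathcal{A}$ be a unital $C^*$-algebra, $\mathcal{H}$ a complex Hilbert space, $P\in\mathscr{B}(\mathcal{H})$ a positive operator, and $\Phi\in\mathrm{CP}^{(P)}(\mathcal{A},\mathscr{B}(\mathcal{H}))$. Then the following are equivalent: (i) $\Phi$ is a $P$-$C^*$-extreme point of $\mathrm{CP}^{(P)}(\mathcal{A},\mathscr{B}(\mathcal{H}))$; (ii) for every completely positive map $\Psi:\mathcal{A}\to\mathscr{B}(\mathcal{H})$ such that $\Psi\leq_{cp}\Phi$ and $\Psi(1)=B^*PB$ for some invertible $B\in\mathscr{B}(\mathcal{H})$, there exists an invertible operator $Z\in\mathscr{B}(\mathcal{H})$ such that $\Psi=\mathrm{Ad}_Z\circ\Phi$.
   Context: $\mathscr{B}(\mathcal{H})$ is the algebra of bounded linear operators on $\mathcal{H}$; $1$ is the unit of $\mathcal{A}$. ''CP'' means completely positive (linear). For $T\in\mathscr{B}(\mathcal{H})$, $\mathrm{Ad}_T(X):=T^*XT$ for $X\in\mathscr{B}(\mathcal{H})$. For CP maps $\Psi,\Phi$, $\Psi\leq_{cp}\Phi$ means that $\Phi-\Psi$ is CP. For a positive operator $P$, $\mathrm{CP}^{(P)}(\mathcal{A},\mathscr{B}(\mathcal{H}))$ is the set of all CP maps $\Phi:\mathcal{A}\to\mathscr{B}(\mathcal{H})$ with $\Phi(1)=P$. A map $\Phi\in\mathrm{CP}^{(P)}(\mathcal{A},\mathscr{B}(\mathcal{H}))$ is a $P$-$C^*$-extreme point of this set if whenever $\Phi=\sum_{j=1}^n\mathrm{Ad}_{T_j}\circ\Phi_j$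 with $n\ge 1$, $\Phi_j\in\mathrm{CP}^{(P)}(\mathcal{A},\mathscr{B}(\mathcal{H}))$ and $T_j\in\mathscr{B}(\mathcal{H})$ invertible with $\sum_{j=1}^nT_j^*PT_j=P$, there exist invertible $S_j\in\mathscr{B}(\mathcal{H})$ such that $\Phi_j=\mathrm{Ad}_{S_j}\circ\Phi$ for all $1\leq j\leq n$. *)

(* Defs.v *)
From HB Require Import structures.
From mathcomp Require Import all_boot all_order all_algebra sesquilinear.
From mathcomp Require Import complex.
From mathcomp Require Import all_classical all_reals topology normedtype.

Set Implicit Arguments.
Unset Strict Implicit.
Unset Printing Implicit Defensive.

Import Order.TTheory GRing.Theory Num.Theory.
Import numFieldNormedType.Exports.

Local Open Scope classical_set_scope.
Local Open Scope complex_scope.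
Local Open Scope ring_scope.

(* Inner products are linear in the first argument, as {dot _ for _}. *)
HB.mixin Record isHilbert (R : realType) H & CompleteNormedModule R[i] H := {
  inner : {dot H for Num.conj};
  norm_inner : forall x : H, `|x| ^+ 2 = inner x x
}.

#[short(type="hilbertType")]
HB.structure Definition Hilbert (R : realType) :=
  {H of isHilbert R H & CompleteNormedModule R[i] H}.

(* The library has no join of rings and normed modules below numDomainType, so *)
(* the product and the unit are fields here, and the ring structure of A is    *)
(* then an instance on the carrier. 1 = 0 is allowed (zero algebra).           *)
HB.mixin Record isCstarAlgebra (R : realType) A
    & CompleteNormedModule R[i] A := {
  cstar_one : A;
  cstar_mul : A -> A -> A;
  cstar_mulA : associative cstar_mul;
  cstar_mul1 : left_id cstar_one cstar_mul;
  cstar_mulr1 : right_id cstar_one cstar_mul;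
  cstar_mulDl : left_distributive cstar_mul +%R;
  cstar_mulDr : right_distributive cstar_mul +%R;
  cstar_scaleAl : forall (c : R[i]) (x y : A),
    c *: cstar_mul x y = cstar_mul (c *: x) y;
  cstar_scaleAr : forall (c : R[i]) (x y : A),
    c *: cstar_mul x y = cstar_mul x (c *: y);
  cstar_normM : forall x y : A, `|cstar_mul x y| <= `|x| * `|y|;
  star : A -> A;
  starK : involutive star;
  starD : {morph star : x y / x + y};
  starZ : forall (c : R[i]) (x : A), star (c *: x) = Num.conj c *: star x;
  starM : forall x y : A,
    star (cstar_mul x y) = cstar_mul (star y) (star x);
  cstar_norm : forall x : A, `|cstar_mul (star x) x| = `|x| ^+ 2
}.

#[short(type="cstarAlgType")]
HB.structure Definition CstarAlgebra (R : realType) :=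
  {A of isCstarAlgebra R A & CompleteNormedModule R[i] A}.

#[non_forgetful_inheritance]
HB.instance Definition _ (R : realType) (A : cstarAlgType R) :=
  GRing.Zmodule_isPzRing.Build A (@cstar_mulA R A) (@cstar_mul1 R A)
    (@cstar_mulr1 R A) (@cstar_mulDl R A) (@cstar_mulDr R A).

Section BoundedOperators.
Context {R : realType} {H : hilbertType R}.

Definition bounded_linear : pred (H -> H) := fun f =>
  `[< linear f /\ exists M : R[i], forall x, `|f x| <= M * `|x| >].

Record bop := Bop { bop_fun :> H -> H; _ : bounded_linear bop_fun }.

HB.instance Definition _ := [isSub for bop_fun].
HB.instance Definition _ := [Choice of bop by <:].

Lemma bopP (T : bop) :
  linear T /\ exists M : R[i], forall x, `|T x| <= M * `|x|.
Proof. by case: T => f /= /asboolP. Qed.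

Fact bounded_linear_submod : submod_closed (bounded_linear : {pred H -> H}).
Proof.
split=> [|c f g /asboolP[lf [M hM]] /asboolP[lg [N hN]]].
  apply/asboolP; split; first by move=> a x y /=; rewrite scaler0 addr0.
  by exists 0 => x; rewrite mul0r normr0.
apply/asboolP; split.
  move=> a x y; rewrite !fctE lf lg !scalerDr !scalerA addrACA.
  by rewrite [c * a]mulrC.
exists (`|c| * M + N) => x; rewrite !fctE.
rewrite (le_trans (ler_normD _ _))// mulrDl lerD// normrZ -mulrA.
exact: ler_wpM2l.
Qed.

HB.instance Definition _ :=
  GRing.isSubmodClosed.Build _ _ bounded_linear bounded_linear_submod.
HB.instance Definition _ := [SubChoice_isSubLmodule of bop by <:].

Fact bop_one_subproof : bounded_linear idfun.
Proof. by apply/asboolP; split=> //; exists 1 => x; rewrite mul1r. Qed.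
Definition bop_one : bop := Bop bop_one_subproof.

Fact bop_mul_subproof (S T : bop) : bounded_linear (S \o T).
Proof.
have [lS [M hM]] := bopP S; have [lT [N hN]] := bopP T.
apply/asboolP; split=> [a x y|]; first by rewrite /= lT lS.
exists (`|M| * N) => x /=.
have [y0|y0] := eqVneq (T x) 0.
  have := hM (T x); rewrite y0 normr0 mulr0 => S0.
  by rewrite (le_trans S0)// -mulrA mulr_ge0// (le_trans _ (hN x)).
have M0 : 0 <= M.
  rewrite -(pmulr_lge0 _ (_ : 0 < `|T x|)) ?normr_gt0//.
  exact: le_trans (hM _).
by rewrite (le_trans (hM _))// ger0_norm// -mulrA ler_wpM2l.
Qed.
Definition bop_mul (S T : bop) : bop := Bop (bop_mul_subproof S T).

Lemma bop_eqP (S T : bop) : (S : H -> H) =1 T <-> S = T.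
Proof. by split=> [ST|->//]; apply/val_inj/funext. Qed.

Fact bop_mulA : associative bop_mul.
Proof. by move=> S T U; apply/bop_eqP. Qed.
Fact bop_mul1 : left_id bop_one bop_mul.
Proof. by move=> S; apply/bop_eqP. Qed.
Fact bop_mulr1 : right_id bop_one bop_mul.
Proof. by move=> S; apply/bop_eqP. Qed.
Fact bop_mulDl : left_distributive bop_mul +%R.
Proof. by move=> S T U; apply/bop_eqP. Qed.
Fact bop_mulDr : right_distributive bop_mul +%R.
Proof.
move=> S T U; apply/bop_eqP => x /=; have [lS _] := bopP S.
by have := lS 1 (T x) (U x); rewrite !scale1r.
Qed.

HB.instance Definition _ := GRing.Zmodule_isPzRing.Build bop
  bop_mulA bop_mul1 bop_mulr1 bop_mulDl bop_mulDr.

End BoundedOperators.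
Arguments bop {R} H.

Notation "''B' ( H )" := (bop H) (format "''B' ( H )") : type_scope.

Section Operators.
Context {R : realType} {H : hilbertType R}.
Implicit Types P S T X : 'B(H).

(* The S with <T x, y> = <x, S y> is unique, and exists by the Riesz           *)
(* representation theorem, so the default 0 is never used.                     *)
Definition adj T : 'B(H) :=
  xget 0 [set S : 'B(H) | forall x y : H, inner (T x) y = inner x (S y)].

Definition Ad T (X : 'B(H)) : 'B(H) := adj T * X * T.

Definition bop_invertible T := exists S, S * T = 1 /\ T * S = 1.

Definition bop_pos P := forall x : H, 0 <= inner (P x) x.

(* Positivity of the operator on H^n with matrix M, under M_n(B(H)) = B(H^n).  *)
Definition bopmx_pos n (M : 'M['B(H)]_n) :=
  forall x : 'I_n -> H, 0 <= \sum_i \sum_j inner (M i j (x j)) (x i).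

End Operators.

Section CompletelyPositive.
Context {R : realType} {A : cstarAlgType R} {H : hilbertType R}.
Implicit Types (P : 'B(H)) (Phi Psi : A -> 'B(H)).

(* Positivity in the C*-algebra M_n(A): M = N^* N for some N in M_n(A).        *)
Definition cstarmx_pos n (M : 'M[A]_n) :=
  exists N : 'M[A]_n, M = map_mx star N^T *m N.

Definition cp Phi :=
  linear Phi /\
  forall n (M : 'M[A]_n), cstarmx_pos M -> bopmx_pos (map_mx Phi M).

Definition le_cp Psi Phi := cp (fun a => Phi a - Psi a).

Definition CP P : set (A -> 'B(H)) := [set Phi | cp Phi /\ Phi 1 = P].

Definition Cstar_extreme P Phi :=
  CP P Phi /\
  forall n (T : 'I_n -> 'B(H)) (Phi_ : 'I_n -> A -> 'B(H)),
    (1 <= n)%N ->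
    (forall j, CP P (Phi_ j)) ->
    (forall j, bop_invertible (T j)) ->
    \sum_j adj (T j) * P * T j = P ->
    Phi = (fun a => \sum_j Ad (T j) (Phi_ j a)) ->
    exists S : 'I_n -> 'B(H), forall j,
      bop_invertible (S j) /\ Phi_ j = Ad (S j) \o Phi.

End CompletelyPositive.

(* Main.v *)
(* For (ii) => (i), apply (ii) to Ad_{T_j} o Phi_j, which is dominated by Phi.

   For (i) => (ii), let Psi <= Phi and Psi(1) = B^* P B. The value of Phi - Psi
   at 1 need not be C^* P C with C invertible, but that of Phi - Psi/4 is:
   Q = P - Psi(1)/4 satisfies 3P/4 <= Q <= P, so sqrt P and sqrt Q have the
   same kernel and, by Douglas factorisation on its orthogonal complement,
   sqrt P C = sqrt Q with C invertible. Then
     Phi = Ad_{B/2} o (Ad_{B^-1} o Psi) + Ad_C o (Ad_{C^-1} o (Phi - Psi/4))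
   is a proper C^*-convex combination, and (i) applies to its first term. *)

Require Import Defs.
From HB Require Import structures.
From mathcomp Require Import all_boot all_order all_algebra.
From mathcomp Require Import sesquilinear complex.
From mathcomp Require Import all_classical all_reals topology normedtype.
From mathcomp Require Import ring lra.

Import Order.TTheory GRing.Theory Num.Theory.
Local Open Scope complex_scope.
Local Open Scope ring_scope.
Set Implicit Arguments.
Unset Strict Implicit.
Unset Printing Implicit Defensive.

(** * Real inner product, Cauchy-Schwarz and limits with a rate *)

Section RealInner.
Context {R : realType} {H : hilbertType R}.
Implicit Types (x y z : H) (t : R).

Definition rnorm x : R := complex.Re `|x|.
Definition rinner x y : R := complex.Re (inner x y).

Lemma normE x : `|x| = (rnorm x)%:C.
Proof. by rewrite RRe_real// normr_real. Qed.

Lemma le_norm_rnorm (M : R[i]) x y :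
  (`|x| <= M * `|y|) -> rnorm x <= complex.Re M * rnorm y.
Proof.
rewrite !normE lecE => /andP[_ /=].
by case: M => a b /=; rewrite mulr0 subr0.
Qed.

Lemma rnorm_ge0 x : 0 <= rnorm x.
Proof. by rewrite -ler0c -normE. Qed.

Lemma rnorm0_eq0 x : rnorm x = 0 -> x = 0.
Proof. by move=> x0; apply/normr0_eq0; rewrite normE x0. Qed.

Lemma rnormD x y : rnorm (x + y) <= rnorm x + rnorm y.
Proof. by rewrite -lecR rmorphD/= -!normE ler_normD. Qed.

Lemma rnormN x : rnorm (- x) = rnorm x.
Proof. by rewrite /rnorm normrN. Qed.

Lemma rnormB x y : rnorm (x - y) = rnorm (y - x).
Proof. by rewrite -rnormN opprB. Qed.

Lemma rnormZ t x : rnorm (t%:C *: x) = `|t| * rnorm x.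
Proof.
apply: complexI; rewrite -normE normrZ normc_def/= expr0n/= addr0.
by rewrite sqrtr_sqr normE -rmorphM.
Qed.

Lemma rnorm_inner x : rnorm x ^+ 2 = rinner x x.
Proof. by rewrite /rinner -norm_inner normE -rmorphXn. Qed.

Lemma innerC x y : inner x y = Num.conj (inner y x).
Proof. by rewrite hermC expr0 mul1r. Qed.

Lemma ReJ (c : R[i]) : complex.Re (Num.conj c) = complex.Re c.
Proof. by case: c. Qed.

Lemma rinnerC x y : rinner x y = rinner y x.
Proof. by rewrite /rinner innerC ReJ. Qed.

Lemma rinnerDl x y z : rinner (x + y) z = rinner x z + rinner y z.
Proof.
by rewrite /rinner linearDl/=; case: (inner x z) (inner y z) => ? ? [].
Qed.
Lemma rinnerDr x y z : rinner z (x + y) = rinner z x + rinner z y.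
Proof. by rewrite rinnerC rinnerDl 2!(rinnerC z). Qed.
Lemma rinnerZl t x z : rinner (t%:C *: x) z = t * rinner x z.
Proof.
rewrite /rinner linearZl_LR/=; case: (inner x z) => ? ?/=.
by rewrite mul0r subr0.
Qed.
Lemma rinnerZr t x z : rinner z (t%:C *: x) = t * rinner z x.
Proof. by rewrite rinnerC rinnerZl rinnerC. Qed.
Lemma rinnerNl x z : rinner (- x) z = - rinner x z.
Proof. by rewrite -(mulN1r (rinner _ _)) -rinnerZl rmorphN scaleN1r. Qed.
Lemma rinnerNr x z : rinner z (- x) = - rinner z x.
Proof. by rewrite rinnerC rinnerNl rinnerC. Qed.
Lemma rinnerBl x y z : rinner (x - y) z = rinner x z - rinner y z.
Proof. by rewrite rinnerDl rinnerNl. Qed.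
Lemma rinnerBr x y z : rinner z (x - y) = rinner z x - rinner z y.
Proof. by rewrite rinnerDr rinnerNr. Qed.

(** Conjugate-linearity in the second slot gives Re <x, iy> = Im <x, y>, so real parts determine the
    whole form. *)
Lemma innerE x y : inner x y = rinner x y +i* rinner x ('i%C *: y).
Proof.
rewrite /rinner linearZr_LR/=; case: (inner x y) => a b /=.
by rewrite mul0r sub0r mulN1r opprK.
Qed.

Lemma innerE_l x y : inner x y = rinner x y -i* rinner ('i%C *: x) y.
Proof.
rewrite /rinner linearZl_LR/=; case: (inner x y) => a b /=.
by rewrite mul0r sub0r mul1r opprK.
Qed.

Lemma rnorm_sqB x y : rnorm (x - y) ^+ 2 =
  rnorm x ^+ 2 - 2 * rinner x y + rnorm y ^+ 2.
Proof.
rewrite !rnorm_inner !(rinnerBl, rinnerBr) (rinnerC y x); ring.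
Qed.

Lemma rnorm_sqD x y : rnorm (x + y) ^+ 2 =
  rnorm x ^+ 2 + 2 * rinner x y + rnorm y ^+ 2.
Proof.
rewrite !rnorm_inner !(rinnerDl, rinnerDr) (rinnerC y x); ring.
Qed.

(** Cauchy-Schwarz comes from squaring the triangle inequality of the norm. *)
Lemma rinner_le x y : rinner x y <= rnorm x * rnorm y.
Proof.
have := rnormD x y; rewrite -ler_sqr ?nnegrE ?addr_ge0 ?rnorm_ge0//.
by rewrite rnorm_sqD sqrrD; lra.
Qed.

Lemma abs_rinner_le x y : `|rinner x y| <= rnorm x * rnorm y.
Proof.
rewrite ler_norml rinner_le andbT lerNl -rinnerNl.
by rewrite (le_trans (rinner_le _ _))// rnormN.
Qed.

(** Completeness with the tail bound [r] kept in the limit; both limit constructions below go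
    through it. *)
Lemma rnorm_limit (u : nat -> H) (r : nat -> R) :
  (forall n m, (n <= m)%N -> rnorm (u m - u n) <= r n) ->
  (forall e, 0 < e -> exists n, r n < e) ->
  exists l, forall n, rnorm (l - u n) <= r n.
Proof.
move=> ur r0.
have /cauchy_cvgP/cvg_ex[l ul] : cauchy (u @ \oo)%classic.
  apply: cauchy_exP => eps eps0.
  have epsE : eps = (complex.Re eps)%:C by rewrite RRe_real// gtr0_real.
  have [|n rn] := r0 (complex.Re eps); first by rewrite -ltcR -epsE.
  exists (u n); exists n => // m /= nm.
  rewrite -ball_normE/= normE epsE ltcR (le_lt_trans _ rn)//.
  by rewrite rnormB ur.
exists l => n; apply/ler_addgt0Pr => e e0.
have e0' : 0 < e%:C by rewrite ltcR.
have /cvgrPdist_lt/(_ _ e0')[m _ mul] := ul.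
have := mul (maxn n m) (leq_maxr _ _); rewrite normE ltcR => lu.
rewrite -(subrKA (u (maxn n m))) (le_trans (rnormD _ _))// addrC.
by rewrite lerD ?ur ?leq_maxl// ltW.
Qed.

End RealInner.

(** * Bounded operators with real bounds *)

Section Operators.
Context {R : realType} {H : hilbertType R}.
Implicit Types (P Q S T A C D M X : 'B(H)) (x y z : H) (t : R).

Lemma bopD T x y : T (x + y) = T x + T y.
Proof. by have [lT _] := bopP T; have := lT 1 x y; rewrite !scale1r. Qed.
Lemma bopZ T c x : T (c *: x) = c *: T x.
Proof.
have [lT _] := bopP T; have T0 : T 0 = 0.
  by apply: (@addrI _ (T 0)); rewrite -bopD !addr0.
by have := lT c x 0; rewrite T0 !addr0.
Qed.
Lemma bopN T x : T (- x) = - T x.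
Proof. by rewrite -scaleN1r bopZ scaleN1r. Qed.
Lemma bopB T x y : T (x - y) = T x - T y.
Proof. by rewrite bopD bopN. Qed.

Lemma bop_bound T :
  exists2 c : R, 0 <= c & forall x, rnorm (T x) <= c * rnorm x.
Proof.
have [_ [M hM]] := bopP T; exists `|complex.Re M| => // x.
rewrite (le_trans (le_norm_rnorm (hM x)))// ler_wpM2r ?rnorm_ge0//.
exact: ler_norm.
Qed.

Lemma bop_build (f : H -> H) (c : R) : linear f ->
  (forall x, rnorm (f x) <= c * rnorm x) -> exists T, forall x, T x = f x.
Proof.
move=> lf fc; suff bf : bounded_linear f by exists (Bop bf).
apply/asboolP; split=> //; exists c%:C => x.
by rewrite !normE -rmorphM lecR fc.
Qed.

(** * Variational construction of Douglas factors *)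

(** First-order condition for a minimum that is only approached, hence the arbitrary slack [e]. *)
Lemma small_quadratic (a b : R) : 0 <= a ->
  (forall t e, 0 < e -> - e <= t ^+ 2 * a + t * b) -> b = 0.
Proof.
move=> a0 h; have {}h t : 0 <= t ^+ 2 * a + t * b.
  by apply/ler_addgt0Pr => e /(h t); lra.
have a1 : 0 < a + 1 by lra.
(* At [t = - s] the quadratic takes the value - s^2; the shift by 1 covers [a = 0]. *)
have := h (- (b / (a + 1))); set s := b / (a + 1).
have -> : b = s * (a + 1) by rewrite divfK// gt_eqF.
move=> hs; have : s ^+ 2 = 0 by apply: le_anti; rewrite sqr_ge0 andbT; nra.
by move/eqP; rewrite sqrf_eq0 => /eqP->; rewrite mul0r.
Qed.

(* y is the limit of A z_n along a minimising sequence of the convex functional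
   z |-> |A z|^2 - 2 Re <S z, x>; for A = 1 this is Riesz representation. *)
Lemma factor_vector A S (c : R) x : 0 <= c ->
  (forall z, rnorm (S z) <= c * rnorm (A z)) ->
  exists y, [/\ forall z, rinner (S z) x = rinner (A z) y,
    rnorm y <= c * rnorm x &
    forall k, (forall z, rinner (A z) k = 0) -> rinner y k = 0].
Proof.
move=> c0 SA; pose K := c * rnorm x.
have K0 : 0 <= K by rewrite mulr_ge0 ?rnorm_ge0.
have fK z : rinner (S z) x <= K * rnorm (A z).
  rewrite (le_trans (rinner_le _ _))// /K mulrAC ler_wpM2r ?rnorm_ge0//.
pose F z := rnorm (A z) ^+ 2 - 2 * rinner (S z) x.
have FK z : - K ^+ 2 <= F z.
  by rewrite /F; have := fK z; have := sqr_ge0 (rnorm (A z) - K); nra.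
pose E : set R := [set F z | z in setT]%classic.
have lbE : has_inf E.
  by split; [exists (F 0); exists 0|exists (- K ^+ 2) => _ [z _ <-]].
pose m := inf E.
have mF z : m <= F z by apply: ge_inf; [case: lbE|exists z].
have /choice[zs zsP] n : exists z, F z < m + n.+1%:R^-1.
  have [|_ [z _ <-] Fz] := inf_adherent (_ : 0 < n.+1%:R^-1 :> R) lbE.
    by rewrite invr_gt0.
  by exists z.
(* Parallelogram law: the functional at the midpoint of [z] and [w] is still at least [m], so [A]
   maps minimising sequences to Cauchy sequences. *)
have par z w : rnorm (A z - A w) ^+ 2 <= 2 * (F z - m) + 2 * (F w - m).
  have := mF ((2^-1 : R)%:C *: (z + w)).
  rewrite /F !(bopZ, bopD) rinnerZl rinnerDl rnormZ exprMn.
  rewrite real_normK ?num_real// rnorm_sqB rnorm_sqD.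
  set a := rinner (S z) x; set b := rinner (S w) x.
  set d := rinner (A z) (A w); set p := rnorm (A z) ^+ 2.
  set q := rnorm (A w) ^+ 2.
  lra.
have inv0 (e : R) : 0 < e -> exists n, 2 * Num.sqrt n.+1%:R^-1 < e.
  move=> e0; have e20 : 0 < (e / 2) ^+ 2 by rewrite exprn_gt0 ?divr_gt0.
  exists (Num.truncn ((e / 2) ^+ 2)^-1).
  rewrite mulrC -ltr_pdivlMr// -[ltRHS]ger0_norm ?divr_ge0 1?ltW//.
  rewrite -sqrtr_sqr ltr_sqrt// invf_plt ?posrE//.
  by rewrite truncnS_gt// invr_ge0 ltW.
(* Two gaps below 1/(n+1) give, by [par], a squared distance below 4/(n+1). *)
have [y yP] : exists y, forall n,
    rnorm (y - A (zs n)) <= 2 * Num.sqrt n.+1%:R^-1.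
  apply: rnorm_limit => // n k nk.
  rewrite -ler_sqr ?nnegrE ?mulr_ge0 ?sqrtr_ge0 ?rnorm_ge0//.
  rewrite exprMn sqr_sqrtr ?invr_ge0//.
  have kn : (k.+1%:R^-1 : R) <= n.+1%:R^-1.
    by rewrite lef_pV2 ?posrE// ler_nat.
  have := par (zs k) (zs n); have := zsP k; have := zsP n; move: kn.
  move: (k.+1%:R^-1) (n.+1%:R^-1) => v w vw; rewrite expr2; lra.
have app (e : R) : 0 < e -> exists z, rnorm (y - A z) < e /\ F z < m + e.
  move=> e0; have [|n] := inv0 (Num.min e 1); first by rewrite lt_min e0 ltr01.
  rewrite lt_min => /andP[ne n1]; exists (zs n).
  split; first exact: le_lt_trans (yP n) _.
  rewrite (lt_trans (zsP n))// ltrD2l.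
  have : 0 <= (n.+1%:R^-1 : R) by rewrite invr_ge0.
  move: ne n1; move: (n.+1%:R^-1) => v ne n1 v0.
  have sv := sqr_sqrtr v0; have s0 := sqrtr_ge0 v.
  by rewrite -sv; nra.
exists y; have eqy z : rinner (S z) x = rinner (A z) y.
  apply/eqP; rewrite eq_sym -subr_eq0; apply/eqP.
  set b := _ - _; suff: 2 * b = 0 by lra.
  apply: (@small_quadratic (rnorm (A z) ^+ 2)); first exact: sqr_ge0.
  move=> t e e0; set a := rnorm (A z).
  have a0 : 0 <= a by exact: rnorm_ge0.
  (* [y] need not lie in the range of [A], so the variation is taken at a near-minimiser [w]; this
     [d] makes the total error d + 2 |t| a d equal to [e]. *)
  pose d := e / (1 + 2 * `|t| * a).
  have q0 : 0 < 1 + 2 * `|t| * a by have := mulr_ge0 (normr_ge0 t) a0; nra.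
  have d0 : 0 < d by rewrite divr_gt0.
  have [w [yw Fw]] := app d d0.
  have := mF (w + t%:C *: z); move: Fw.
  rewrite /F !(bopD, bopZ) rnorm_sqD rnormZ rinnerDl !rinnerZl rinnerZr.
  rewrite exprMn real_normK ?num_real// -/a => Fw mw.
  have yA : t * rinner (A w) (A z) - t * rinner (A z) y <= `|t| * (d * a).
    rewrite -mulrBr (rinnerC (A z)) -rinnerBl (le_trans (ler_norm _))// normrM.
    rewrite ler_wpM2l// (le_trans (abs_rinner_le _ _))// rnormB.
    by rewrite ler_wpM2r// ltW.
  have : d * (1 + 2 * `|t| * a) = e by rewrite divfK// gt_eqF.
  by rewrite /b; move: yA Fw mw; nra.
split=> //.
  (* For [A z] within eps of [y], |y|^2 = <y - Az, y> + <Sz, x> is at most eps |y| + K (|y| + eps);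
     with eps = (|y| - K)/2 this contradicts |y| > K. *)
  rewrite leNgt; apply/negP => Ky; have := app ((rnorm y - K) / 2).
  case=> [|z [yz _]]; first by rewrite divr_gt0// subr_gt0.
  have := rnorm_inner y; rewrite -[X in rinner X y](subrK (A z)) rinnerDl -eqy.
  have := fK z; have := rinner_le (y - A z) y.
  have := rnormD (A z - y) y; rewrite subrK (rnormB _ y).
  by have := rnorm_ge0 y; have := rnorm_ge0 (y - A z); nra.
(* [y] is a limit of vectors [A z], so it inherits orthogonality to [k] from the range. *)
move=> k Ak; apply/eqP; rewrite -normr_eq0 eq_le normr_ge0 andbT.
apply/ler_addgt0Pr => e e0; rewrite add0r.
have k0 : 0 < rnorm k + 1 by have := rnorm_ge0 k; lra.
have [|z [yz _]] := app (e / (rnorm k + 1)); first by rewrite divr_gt0.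
rewrite -(subrK (A z) y) rinnerDl Ak addr0 (le_trans (abs_rinner_le _ _))//.
have : e / (rnorm k + 1) * (rnorm k + 1) = e by rewrite divfK// gt_eqF.
by have := rnorm_ge0 k; nra.
Qed.

Lemma rinner_ext x y : (forall z, rinner z x = rinner z y) -> x = y.
Proof.
move=> xy; apply/eqP; rewrite -subr_eq0; apply/eqP/rnorm0_eq0/eqP.
by rewrite -sqrf_eq0 rnorm_inner rinnerBr xy subrr.
Qed.

Lemma inner_ext A S x y :
  (forall z, rinner (S z) x = rinner (A z) y) ->
  forall z, inner (S z) x = inner (A z) y.
Proof. by move=> h z; rewrite !innerE_l -!bopZ !h. Qed.

(** Douglas factorisation, S^* = A^* C. Orthogonality to the complement of the range of [A] makes
    the vector from [factor_vector] unique, and uniqueness makes it linear in [x]. *)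
Lemma bop_factor A S (c : R) : 0 <= c ->
  (forall z, rnorm (S z) <= c * rnorm (A z)) ->
  exists C : 'B(H), (forall z x, rinner (S z) x = rinner (A z) (C x)) /\
    forall x k, (forall z, rinner (A z) k = 0) -> rinner (C x) k = 0.
Proof.
move=> c0 SA; have /choice[f fP] := fun x => factor_vector x c0 SA.
have uniq_f x y : (forall z, rinner (S z) x = rinner (A z) y) ->
    (forall k, (forall z, rinner (A z) k = 0) -> rinner y k = 0) -> f x = y.
  have [fS _ fk] := fP x => yS yk.
  apply/eqP; rewrite -subr_eq0; apply/eqP/rnorm0_eq0/eqP.
  rewrite -sqrf_eq0 rnorm_inner; apply/eqP.
  have Ak z : rinner (A z) (f x - y) = 0 by rewrite rinnerBr -fS yS subrr.
  by rewrite {1}rinnerBl fk ?yk ?subrr.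
have [|C Cf] := @bop_build f c _ (fun x => let: And3 _ h _ := fP x in h).
  move=> a x y; have [Sx _ kx] := fP x; have [Sy _ ky] := fP y.
  apply: uniq_f => [z|k Ak].
    have /(_ z) Sx' := inner_ext Sx; have /(_ z) Sy' := inner_ext Sy.
    by rewrite /rinner !(linearDr, linearZr_LR)/= Sx' Sy'.
  (* The range of [A] is a complex subspace, so multiplication by i preserves real orthogonality to
     it. *)
  have Ak' z : rinner (A z) ('i%C *: k) = 0.
    rewrite /rinner linearZr_LR/= (@inner_ext A A k 0) ?linear0r ?mulr0// => w.
    by rewrite Ak /rinner linear0r.
  have ik : inner (f x) k = 0 by rewrite innerE !kx.
  by rewrite rinnerDl ky// /rinner linearZl_LR/= ik mulr0 addr0.
exists C; split=> [z x|x k]; rewrite Cf; have [fS _ fk] := fP x => //.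
exact: fk.
Qed.

(** * Adjoints and positive operators *)

(** Existence is the factorisation through the identity, that is, Riesz representation. *)
Lemma adjP T x y : inner (T x) y = inner x (adj T y).
Proof.
rewrite /adj; case: xgetP => [S _ //|no]; exfalso.
have [c c0 Tc] := bop_bound T.
have [|C [TC _]] := @bop_factor (1 : 'B(H)) T c c0; first exact: Tc.
apply: (no C) => u v; exact: (@inner_ext 1 T v (C v)).
Qed.

Lemma rinner_adj T x y : rinner (T x) y = rinner x (adj T y).
Proof. by rewrite /rinner adjP. Qed.

Lemma rinner_adjl T x y : rinner (adj T x) y = rinner x (T y).
Proof. by rewrite rinnerC -rinner_adj rinnerC. Qed.

Lemma bop_mulE S T x : (S * T) x = S (T x). Proof. by []. Qed.
Lemma bop_oneE x : (1 : 'B(H)) x = x. Proof. by []. Qed.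
Lemma bop_addE S T x : (S + T) x = S x + T x. Proof. by []. Qed.
Lemma bop_oppE T x : (- T) x = - T x. Proof. by []. Qed.
Lemma bop_scaleE c T x : (c *: T) x = c *: T x. Proof. by []. Qed.

Definition bopE := (bop_mulE, bop_oneE, bop_addE, bop_oppE, bop_scaleE).

Lemma adj_unique T S :
  (forall x y, rinner (T x) y = rinner x (S y)) -> adj T = S.
Proof.
move=> TS; apply/bop_eqP => y; apply: rinner_ext => x.
by rewrite -rinner_adj TS.
Qed.

Lemma adjM S T : adj (S * T) = adj T * adj S.
Proof. by apply: adj_unique => x y; rewrite !bopE !rinner_adj. Qed.

Lemma adj_scale t T : adj (t%:C *: T) = t%:C *: adj T.
Proof.
by apply: adj_unique => x y; rewrite !bopE rinnerZl rinnerZr rinner_adj.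
Qed.

Lemma rinner_i x y : rinner x ('i%C *: y) = - rinner ('i%C *: x) y.
Proof. by have := innerE x y; rewrite innerE_l => -[->]. Qed.

Lemma bop_pos_rinner P x : bop_pos P -> 0 <= rinner (P x) x.
Proof. by move=> /(_ x); rewrite lecE => /andP[]. Qed.

(** The order of [R[i]] forces <Px, x> to be real, and polarisation turns this into symmetry. *)
Lemma bop_pos_adj P : bop_pos P -> adj P = P.
Proof.
move=> P0; have b0 x : rinner (P x) ('i%C *: x) = 0.
  by have := P0 x; rewrite lecE innerE/= => /andP[/eqP].
have anti x y : rinner (P x) ('i%C *: y) = - rinner (P y) ('i%C *: x).
  have := b0 (x + y); rewrite bopD scalerDr !(rinnerDl, rinnerDr) !b0; lra.
apply: adj_unique => x y; have := anti x ('i%C *: y).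
rewrite scalerA -expr2 sqr_i scaleN1r rinnerNr bopZ rinner_i.
rewrite scalerA -expr2 sqr_i scaleN1r rinnerNl opprK (rinnerC x).
by move/oppr_inj.
Qed.

(** * Square roots of positive operators *)

Lemma rnormZc (a : R[i]) x : rnorm (a *: x) = complex.Re `|a| * rnorm x.
Proof.
apply: complexI; rewrite -normE normrZ normE rmorphM/= RRe_real//.
exact: normr_real.
Qed.

(* The limit Z solves 2 Z = T + Z^2, so (1 - Z)^2 = 1 - T. As |T| <= 1, the
   increments are dominated in norm by those of the scalar iteration for T = 1,
   which is sqrt_rate. *)
Fixpoint sqrt_iter T n : 'B(H) :=
  if n is n'.+1 then (2^-1 : R)%:C *: (T + sqrt_iter T n' * sqrt_iter T n')
  else 0.

Fixpoint sqrt_rate n : R :=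
  if n is n'.+1 then 2^-1 * (1 + sqrt_rate n' ^+ 2) else 0.

Lemma sqrt_rate_ge0 n : 0 <= sqrt_rate n.
Proof. by case: n => //= n; have := sqr_ge0 (sqrt_rate n); lra. Qed.

Lemma sqrt_rate_le1 n : sqrt_rate n <= 1.
Proof. by elim: n => //= n s1; have := sqrt_rate_ge0 n; nra. Qed.

Lemma sqrt_rateS n : sqrt_rate n <= sqrt_rate n.+1.
Proof. by rewrite /=; have := sqr_ge0 (1 - sqrt_rate n); nra. Qed.

(** The gap g = 1 - s evolves by g |-> g (1 - g/2), hence decays like 2/n; the shift to n + 2
    matches g = 1 at the start. *)
Lemma sqrt_rate_gap n : 1 - sqrt_rate n <= 2 / n.+2%:R.
Proof.
elim: n => [|n]; first by rewrite subr0 divff// pnatr_eq0.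
have := sqrt_rate_le1 n; have := sqrt_rate_ge0 n.
rewrite /= !ler_pdivlMr// -[n.+3%:R]natr1.
move: (sqrt_rate n) (n.+2%:R : R) => s k s0 s1 sk.
(* With g = 1 - s the product is 2 - g - k g (1 - g/2), so (k + 1) g (1 - g/2) is at most 2 -
   g^2/2. *)
have : 0 <= (2 - (1 - s) * k) * (1 - (1 - s) / 2) by apply: mulr_ge0; lra.
by have := sqr_ge0 (1 - s); nra.
Qed.

(** Since the gap tends to 0, estimates carrying it as a factor pass to the limit. *)
Lemma sqrt_rate_small (u M : R) :
  (forall n, u <= (1 - sqrt_rate n) * M) -> u <= 0.
Proof.
move=> uM; apply/ler_addgt0Pr => e e0; rewrite add0r.
have M0 : 0 <= `|M| by [].
have q0 : 0 < e / (`|M| + 1) by rewrite divr_gt0//; lra.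
pose n := Num.truncn (2 / (e / (`|M| + 1))).
have n2 : 2 / n.+2%:R <= e / (`|M| + 1).
  rewrite ler_pdivrMr// mulrC -ler_pdivrMr// ltW//.
  by rewrite (lt_trans (truncnS_gt _))// ltr_nat.
have qe : e / (`|M| + 1) * (`|M| + 1) = e by rewrite divfK// gt_eqF//; lra.
rewrite (le_trans (uM n))// -qe.
rewrite (@le_trans _ _ ((1 - sqrt_rate n) * (`|M| + 1)))//.
  by rewrite ler_wpM2l ?subr_ge0 ?sqrt_rate_le1//; have := ler_norm M; lra.
by rewrite ler_wpM2r ?(le_trans (sqrt_rate_gap n))//; lra.
Qed.

Section SqrtIter.
Variables (T : 'B(H)) (T1 : forall x, rnorm (T x) <= rnorm x).
Local Notation Z := (sqrt_iter T).
Local Notation s := sqrt_rate.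

Lemma sqrt_iterS n x :
  Z n.+1 x = (2^-1 : R)%:C *: (T x + Z n (Z n x)).
Proof. by []. Qed.

Lemma sqrt_rate_step n : s n.+1 = 2^-1 * (1 + s n ^+ 2).
Proof. by []. Qed.

Lemma rnorm_sqrt_iter n x : rnorm (Z n x) <= s n * rnorm x.
Proof.
elim: n x => [|n IH] x; first by rewrite mul0r /rnorm normr0.
rewrite sqrt_iterS sqrt_rate_step rnormZ ger0_norm ?invr_ge0// -mulrA.
rewrite ler_wpM2l ?invr_ge0//.
rewrite (le_trans (rnormD _ _))// mulrDl mul1r lerD// expr2 -mulrA.
by rewrite (le_trans (IH _))// ler_wpM2l// sqrt_rate_ge0.
Qed.

(** With D = Z(n+1) - Z(n), twice the next increment is Z(n+1) D + D Z(n), and the scalar increments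
    factor in the same way. *)
Lemma rnorm_sqrt_iterS n x :
  rnorm (Z n.+1 x - Z n x) <= (s n.+1 - s n) * rnorm x.
Proof.
elim: n x => [|n IH] x; first by rewrite !subr0 rnorm_sqrt_iter.
have -> : Z n.+2 x - Z n.+1 x = (2^-1 : R)%:C *:
    (Z n.+1 (Z n.+1 x - Z n x) + (Z n.+1 (Z n x) - Z n (Z n x))).
  rewrite (sqrt_iterS n.+1) [X in _ - X]sqrt_iterS -scalerBr.
  rewrite opprD addrACA subrr add0r; congr (_ *: _).
  rewrite bopB addrA; congr (_ - _).
  by rewrite subrK.
rewrite rnormZ ger0_norm ?invr_ge0//.
rewrite (sqrt_rate_step n.+1) [X in (_ - X) * _](sqrt_rate_step n).
rewrite -mulrBr [1 + _]addrC addrKA subr_sqr.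
rewrite -!mulrA ler_wpM2l ?invr_ge0// (le_trans (rnormD _ _))//.
have d0 : 0 <= s n.+1 - s n by rewrite subr_ge0 sqrt_rateS.
rewrite [(s n.+1 + s n) * _]mulrDl mulrDr lerD//.
  rewrite (le_trans (rnorm_sqrt_iter _ _))// mulrCA ler_wpM2l//.
  exact: sqrt_rate_ge0.
by rewrite (le_trans (IH _))// ler_wpM2l// rnorm_sqrt_iter.
Qed.

Lemma rnorm_sqrt_iterB n m x : (n <= m)%N ->
  rnorm (Z m x - Z n x) <= (1 - s n) * rnorm x.
Proof.
move=> nm; suff : rnorm (Z m x - Z n x) <= (s m - s n) * rnorm x.
  move=> /le_trans; apply; rewrite ler_wpM2r ?rnorm_ge0// lerD2r.
  exact: sqrt_rate_le1.
have refl k : rnorm (Z k x - Z k x) <= (s k - s k) * rnorm x.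
  by rewrite !subrr mul0r /rnorm normr0.
elim: m nm => [|m IH]; first by rewrite leqn0 => /eqP->.
rewrite leq_eqVlt => /predU1P[->//|/IH mn].
rewrite -(subrKA (Z m x)) (le_trans (rnormD _ _))//.
by rewrite -[s m.+1 - s n](subrKA (s m)) mulrDl lerD// rnorm_sqrt_iterS.
Qed.

(** [Z'] is the pointwise limit of the iterates; linearity, symmetry and the fixed-point equation
    each follow from an estimate with factor [1 - s n]. *)
Lemma sqrt_iter_limit : exists Z' : 'B(H), (adj T = T -> adj Z' = Z') /\
  forall x, T x + Z' (Z' x) = Z' x + Z' x.
Proof.
have /choice[f fZ] x : exists l, forall n,
    rnorm (l - Z n x) <= (1 - s n) * rnorm x.
  apply: rnorm_limit => [n m|e e0]; first exact: rnorm_sqrt_iterB.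
  apply: contrapT => /forallNP/= h; have e1 : e * 1 <= 0; last by lra.
  apply: (@sqrt_rate_small _ (rnorm x)) => n; rewrite mulr1 leNgt.
  exact/negP.
have eq_lim x y (M : R) : (forall n, rnorm (x - y) <= (1 - s n) * M) -> x = y.
  move=> /sqrt_rate_small xy.
  apply/eqP; rewrite -subr_eq0; apply/eqP/rnorm0_eq0.
  by apply: le_anti; rewrite xy rnorm_ge0.
have f1 x : rnorm (f x) <= 1 * rnorm x by have := fZ x 0%N; rewrite !subr0.
have [|Z' Z'f] := bop_build _ f1.
  move=> a x y; pose r := complex.Re `|a|.
  apply: (eq_lim _ _ (rnorm (a *: x + y) + r * rnorm x + rnorm y)) => n.
  have -> : f (a *: x + y) - (a *: f x + f y) =
      f (a *: x + y) - Z n (a *: x + y) + (a *: (Z n x - f x) + (Z n y - f y)).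
    by rewrite bopD bopZ scalerBr (addrACA (a *: Z n x)) -opprD subrKA.
  rewrite !mulrDr (le_trans (rnormD _ _))// -addrA lerD//.
  rewrite (le_trans (rnormD _ _))// lerD//; last by rewrite rnormB.
  by rewrite rnormZc rnormB mulrCA ler_wpM2l// -ler0c RRe_real ?normr_real.
exists Z'; have {}fZ x n : rnorm (Z' x - Z n x) <= (1 - s n) * rnorm x.
  by rewrite Z'f.
split=> [Tadj|x].
  have Zadj n : adj (Z n) = Z n.
    elim: n => [|n IH]; first apply: adj_unique => x y.
      by rewrite /rinner (_ : Z 0 x = 0)// (_ : Z 0 y = 0)// linear0l linear0r.
    rewrite /= adj_scale; congr (_ *: _); apply: adj_unique => x y.
    by rewrite !bopE rinnerDl rinnerDr !rinner_adj Tadj IH.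
  apply: adj_unique => x y; apply/eqP; rewrite -subr_eq0 -normr_le0.
  apply: (@sqrt_rate_small _ (2 * rnorm x * rnorm y)) => n.
  have -> : rinner (Z' x) y - rinner x (Z' y) =
      rinner (Z' x - Z n x) y - rinner x (Z' y - Z n y).
    by rewrite rinnerBl rinnerBr (rinner_adj (Z n)) Zadj; ring.
  rewrite (le_trans (ler_normB _ _))//.
  have := abs_rinner_le (Z' x - Z n x) y.
  have := abs_rinner_le x (Z' y - Z n y).
  have := ler_wpM2r (rnorm_ge0 y) (fZ x n).
  have := ler_wpM2l (rnorm_ge0 x) (fZ y n).
  lra.
suff : (2^-1 : R)%:C *: (T x + Z' (Z' x)) = Z' x.
  move=> h; rewrite -[in RHS]h -scalerDl -rmorphD/=.
  by rewrite (_ : 2^-1 + 2^-1 = 1 :> R) ?scale1r//; lra.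
apply: (eq_lim _ _ (2 * rnorm x)) => n.
(* The error is Z(n+1) - Z' plus half of Z' Z' - Z(n) Z(n), the latter split in two; each piece has
   a bound with factor [1 - s n]. *)
have -> : (2^-1 : R)%:C *: (T x + Z' (Z' x)) - Z' x =
    (Z n.+1 x - Z' x) +
    (2^-1 : R)%:C *: ((Z' (Z' x) - Z n (Z' x)) + Z n (Z' x - Z n x)).
  rewrite bopB subrKA sqrt_iterS [RHS]addrC addrA; congr (_ - _).
  by rewrite -scalerDr addrCA subrK.
have s1 : 0 <= 1 - s n by rewrite subr_ge0 sqrt_rate_le1.
have h1 : rnorm (Z n.+1 x - Z' x) <= (1 - s n) * rnorm x.
  rewrite rnormB (le_trans (fZ x n.+1))// ler_wpM2r ?rnorm_ge0//.
  by rewrite lerD2l lerN2 sqrt_rateS.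
have h2 : rnorm (Z' (Z' x) - Z n (Z' x)) <= (1 - s n) * rnorm x.
  by rewrite (le_trans (fZ _ n))// ler_wpM2l// -[leRHS]mul1r Z'f f1.
have h3 : rnorm (Z n (Z' x - Z n x)) <= (1 - s n) * rnorm x.
  rewrite (le_trans (rnorm_sqrt_iter _ _))// (le_trans _ (fZ x n))//.
  by rewrite ler_piMl ?rnorm_ge0 ?sqrt_rate_le1.
rewrite (le_trans (rnormD _ _))// rnormZ ger0_norm ?invr_ge0//.
have := rnormD (Z' (Z' x) - Z n (Z' x)) (Z n (Z' x - Z n x)); lra.
Qed.
End SqrtIter.

Lemma contraction_sqrt P : adj P = P ->
  (forall x, 0 <= rinner (P x) x <= rnorm x ^+ 2) ->
  exists A, adj A = A /\ A * A = P.
Proof.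
move=> Padj P01; have T1 x : rnorm ((1 - P) x) <= rnorm x.
  rewrite -ler_sqr ?nnegrE ?rnorm_ge0// !bopE rnorm_sqB (rinnerC x).
  (* The upper bound at [P x] and positivity at [x - P x] together give |Px|^2 <= <Px, x>. *)
  have [/andP[_ Px] /andP[Px0 _]] := (P01 (P x), P01 (x - P x)).
  move: Px0; rewrite bopB !(rinnerBl, rinnerBr) -(rnorm_inner (P x)).
  rewrite (rinner_adj P (P x) x) Padj -rnorm_inner.
  by have /andP[] := P01 x; lra.
have [Z [Zadj TZ]] := sqrt_iter_limit T1.
exists (1 - Z); split.
  apply: adj_unique => x y; rewrite !bopE rinnerBl rinnerBr rinner_adj Zadj//.
  by apply: adj_unique => u v; rewrite !bopE rinnerBl rinnerBr rinner_adj Padj.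
apply/bop_eqP => x; rewrite !bopE bopB.
have -> : Z (Z x) = Z x + Z x - (1 - P) x by rewrite -TZ addrAC subrr add0r.
by rewrite !bopE opprB [Z x + Z x - _ - _]addrAC addrK subrKA subKr.
Qed.

Lemma bop_sqrt P : adj P = P -> (forall x, 0 <= rinner (P x) x) ->
  exists A, adj A = A /\ A * A = P.
Proof.
(* Dividing [P] by d^2 makes it a contraction, as c <= (1 + c)^2; the 1 keeps [d] nonzero. *)
move=> Padj P0; have [c c0 Pc] := bop_bound P; pose d := 1 + c.
have d0 : d != 0 by rewrite gt_eqF// /d; lra.
have [||A [Aadj AA]] := @contraction_sqrt ((d ^- 2)%:C *: P).
- by rewrite adj_scale Padj.
- move=> x; rewrite bopE rinnerZl mulr_ge0 ?invr_ge0 ?sqr_ge0//=.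
  rewrite mulrC ler_pdivrMr ?exprn_even_gt0// (le_trans (rinner_le _ _))//.
  have := Pc x; have := rnorm_ge0 x; rewrite /d => x0 Px.
  rewrite (le_trans (ler_wpM2r x0 Px))// -mulrA -expr2 mulrC.
  by rewrite ler_wpM2l ?sqr_ge0//; nra.
exists (d%:C *: A); split; first by rewrite adj_scale Aadj.
apply/bop_eqP => x; rewrite !bopE bopZ -bop_mulE AA bopE !scalerA -!rmorphM.
by rewrite -expr2 divff ?scale1r// expf_neq0.
Qed.

(** * Congruence of comparable positive operators *)

Lemma rnorm_sq_comp A x : adj A = A -> rnorm (A x) ^+ 2 = rinner (A (A x)) x.
Proof. by move=> Aadj; rewrite rnorm_inner rinner_adj Aadj rinnerC. Qed.

(** Real and complex orthogonality agree here, the kernel being a complex subspace; for self-adjoint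
    [A] this is the closure of the range. *)
Definition ker_perp A v := forall k, A k = 0 -> rinner v k = 0.

Lemma ker_perpB A u v : ker_perp A u -> ker_perp A v -> ker_perp A (u - v).
Proof. by move=> Au Av k Ak; rewrite rinnerBl Au// Av// subrr. Qed.

Lemma ker_perp_eq A u v :
  ker_perp A u -> ker_perp A v -> A u = A v -> u = v.
Proof.
move=> Au Av uv; apply/eqP; rewrite -subr_eq0; apply/eqP/rnorm0_eq0/eqP.
rewrite -sqrf_eq0 rnorm_inner; apply/eqP.
by apply: (ker_perpB Au Av); rewrite bopB uv subrr.
Qed.

(** For self-adjoint operators the Douglas relation reads A C = S. The bound makes [S] vanish on the
    kernel of [A], and injectivity of [A] on the complement carries this over to [C]. *)
Lemma selfadj_factor A S (c : R) : adj A = A -> adj S = S -> 0 <= c ->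
  (forall z, rnorm (S z) <= c * rnorm (A z)) ->
  exists C : 'B(H), [/\ forall x, A (C x) = S x,
    forall x, ker_perp A (C x) & forall k, A k = 0 -> C k = 0].
Proof.
move=> Aadj Sadj c0 SA; have [C [SC Cperp]] := bop_factor c0 SA.
have AC x : A (C x) = S x.
  by apply: rinner_ext => z; rewrite -{1}Aadj -rinner_adj -SC rinner_adj Sadj.
have Cp x : ker_perp A (C x).
  move=> k Ak; apply: Cperp => z.
  by rewrite rinner_adj Aadj Ak /rinner linear0r.
exists C; split=> // k Ak; apply: (ker_perp_eq (Cp k)) => [k' _|].
  by rewrite /rinner linear0l.
have A0 : A 0 = 0 by have := bopB A 0 0; rewrite !subrr.
rewrite A0 AC; apply/rnorm0_eq0/le_anti; rewrite rnorm_ge0 andbT.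
by rewrite (le_trans (SA k))// Ak /rnorm normr0 mulr0.
Qed.

(** [M] is the orthogonal projection onto the complement of the kernel of [A]. There [C] inverts
    [D], while both sums act as the identity on the kernel. *)
Lemma ker_perp_inverse A M C D :
  (forall x, A (M x) = A x) -> (forall x, ker_perp A (M x)) ->
  (forall k, A k = 0 -> M k = 0) ->
  (forall x, ker_perp A (C x)) -> (forall k, A k = 0 -> C k = 0) ->
  (forall x, ker_perp A (D x)) -> (forall x, A (C (D x)) = A x) ->
  (C + (1 - M)) * (D + (1 - M)) = 1.
Proof.
move=> AM Mp M0 Cp C0 Dp ACD; apply/bop_eqP => x.
have MD : M (D x) = D x by apply: (@ker_perp_eq A).
have CD : C (D x) = M x by apply: (@ker_perp_eq A) => //; rewrite ACD AM.
have kx : A (x - M x) = 0 by rewrite bopB AM subrr.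
rewrite !bopE (bopD C) (bopD M) (C0 _ kx) (M0 _ kx) !addr0 CD MD.
rewrite [D x + _ - _]addrAC subrr add0r.
by rewrite addrC subrK.
Qed.

(** The square roots satisfy |Sz| <= |Az| <= 2 |Sz|, so they share their kernel and each factors
    through the other; the identity is added on the common kernel to get invertibility. *)
Lemma pos_congruence P Q : bop_pos P -> bop_pos Q ->
  (forall x, rinner (Q x) x <= rinner (P x) x) ->
  (forall x, rinner (P x) x <= 2 ^+ 2 * rinner (Q x) x) ->
  exists C, bop_invertible C /\ adj C * P * C = Q.
Proof.
move=> P0 Q0 QP PQ.
have [A [Aadj AP]] := bop_sqrt (bop_pos_adj P0) (fun x => bop_pos_rinner x P0).
have [S [Sadj SQ]] := bop_sqrt (bop_pos_adj Q0) (fun x => bop_pos_rinner x Q0).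
have A2 x : rnorm (A x) ^+ 2 = rinner (P x) x by rewrite rnorm_sq_comp// -AP.
have S2 x : rnorm (S x) ^+ 2 = rinner (Q x) x by rewrite rnorm_sq_comp// -SQ.
have SA z : rnorm (S z) <= 1 * rnorm (A z).
  by rewrite mul1r -ler_sqr ?nnegrE ?rnorm_ge0// S2 A2.
have AS z : rnorm (A z) <= 2 * rnorm (S z).
  by rewrite -ler_sqr ?nnegrE ?mulr_ge0 ?rnorm_ge0// exprMn S2 A2.
have AA z : rnorm (A z) <= 1 * rnorm (A z) by rewrite mul1r.
have rnorm00 : rnorm (0 : H) = 0 by rewrite /rnorm normr0.
have kerS k : A k = 0 -> S k = 0.
  move=> Ak; apply/rnorm0_eq0/le_anti; rewrite rnorm_ge0 andbT.
  by rewrite (le_trans (SA k))// Ak rnorm00 mulr0.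
have kerA k : S k = 0 -> A k = 0.
  move=> Sk; apply/rnorm0_eq0/le_anti; rewrite rnorm_ge0 andbT.
  by rewrite (le_trans (AS k))// Sk rnorm00 mulr0.
have [C [AC Cp C0]] := selfadj_factor Aadj Sadj ler01 SA.
have [D [SD Dp D0]] := selfadj_factor Sadj Aadj (ler0n R 2) AS.
(* Factoring [A] through itself yields the projection onto the complement of its kernel. *)
have [M [AM Mp M0]] := selfadj_factor Aadj Aadj ler01 AA.
have {}Dp x : ker_perp A (D x) by move=> k /kerS; apply: Dp.
have {}D0 k : A k = 0 -> D k = 0 by move=> /kerS; apply: D0.
exists (C + (1 - M)); split.
  exists (D + (1 - M)); split; apply: (@ker_perp_inverse A) => // x.
    apply/eqP; rewrite -subr_eq0 -bopB; apply/eqP/kerA.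
    by rewrite bopB SD AC subrr.
  by rewrite AC SD.
have AC' : A * (C + (1 - M)) = S.
  by apply/bop_eqP => x; rewrite !bopE bopD bopB AC AM subrr addr0.
by rewrite -AP mulrA -{1}Aadj -adjM -mulrA AC' Sadj.
Qed.

(** * Conjugation by operators and invertibility *)

Lemma adj1 : adj (1 : 'B(H)) = 1.
Proof. exact: adj_unique. Qed.

Lemma Ad1 X : Ad (1 : 'B(H)) X = X.
Proof. by rewrite /Ad adj1 mul1r mulr1. Qed.

Lemma AdM S T X : Ad S (Ad T X) = Ad (T * S) X.
Proof. by rewrite /Ad adjM !mulrA. Qed.

Lemma Ad_scale t T X : Ad (t%:C *: T) X = (t ^+ 2)%:C *: Ad T X.
Proof.
apply/bop_eqP => x.
by rewrite /Ad adj_scale !bopE !bopZ scalerA -rmorphM -expr2.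
Qed.

Lemma bop_invertibleM S T :
  bop_invertible S -> bop_invertible T -> bop_invertible (S * T).
Proof.
move=> [S' [S'S SS']] [T' [T'T TT']]; exists (T' * S'); split.
  by rewrite mulrA -(mulrA T') S'S mulr1.
by rewrite mulrA -(mulrA S) TT' mulr1.
Qed.

Lemma bop_invertible_scale t T :
  t != 0 -> bop_invertible T -> bop_invertible (t%:C *: T).
Proof.
move=> t0 [T' [/bop_eqP T'T /bop_eqP TT']]; exists ((t^-1)%:C *: T').
split; apply/bop_eqP => x; rewrite !bopE bopZ scalerA -rmorphM/=.
  by rewrite mulVf// scale1r -bop_mulE T'T.
by rewrite mulfV// scale1r -bop_mulE TT'.
Qed.

End Operators.

(** * Closure properties of completely positive maps *)

Section CompletelyPositive.
Context {R : realType} {A : cstarAlgType R} {H : hilbertType R}.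
Implicit Types (T : 'B(H)) (F G : A -> 'B(H)).

Lemma cp_add F G : cp F -> cp G -> cp (fun a => F a + G a).
Proof.
move=> [lF pF] [lG pG]; split=> [c a b|n M M0 x].
  by rewrite lF lG scalerDr addrACA.
rewrite (eq_bigr (fun i => \sum_j inner (map_mx F M i j (x j)) (x i) +
    \sum_j inner (map_mx G M i j (x j)) (x i))) => [|i _].
  by rewrite big_split addr_ge0 ?pF ?pG.
by rewrite -big_split; apply: eq_bigr => j _; rewrite !mxE bopE linearDl.
Qed.

Lemma cp_scale (t : R) F : 0 <= t -> cp F -> cp (fun a => t%:C *: F a).
Proof.
move=> t0 [lF pF]; split=> [c a b|n M M0 x].
  by rewrite lF scalerDr !scalerA mulrC.
rewrite (eq_bigr (fun i => t%:C * \sum_j inner (map_mx F M i j (x j)) (x i))).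
  by rewrite -mulr_sumr mulr_ge0 ?ler0c ?pF.
move=> i _; rewrite mulr_sumr; apply: eq_bigr => j _.
by rewrite !mxE bopE linearZl_LR.
Qed.

Lemma cp_Ad T F : cp F -> cp (Ad T \o F).
Proof.
move=> [lF pF]; split=> [c a b|n M M0 x].
  by apply/bop_eqP => x; rewrite /comp lF /Ad !bopE bopD bopZ.
(* Moving the adjoint across the form turns the sum at [x] into the sum for [F] at [T \o x]. *)
have := pF n M M0 (T \o x); congr (_ <= _).
apply: eq_bigr => i _; apply: eq_bigr => j _.
by rewrite !mxE /comp /Ad !bopE [RHS]innerC -adjP -innerC.
Qed.

Lemma cp0 : cp (fun _ : A => 0 : 'B(H)).
Proof.
split=> [c a b|n M M0 x]; first by rewrite scaler0 addr0.
by rewrite sumr_ge0// => i _; rewrite sumr_ge0// => j _; rewrite mxE linear0l.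
Qed.

(** The predicate allows one summand of a convex combination to be left out. *)
Lemma cp_sum n (P : pred 'I_n) (F : 'I_n -> A -> 'B(H)) :
  (forall i, P i -> cp (F i)) -> cp (fun a => \sum_(i | P i) F i a).
Proof.
move=> Fcp; rewrite (_ : (fun a => _) =
    \big[(fun G K a => G a + K a)/fun=> 0]_(i | P i) F i).
  by apply: big_ind => //; [exact: cp0|move=> *; exact: cp_add].
apply/funext => a; by elim/big_rec2: _ => // i G u Pi ->.
Qed.

Lemma star1 : star (1 : A) = 1.
Proof.
have : star (1 * star 1) = star (star 1) * star 1 :> A by exact: starM.
by rewrite mul1r starK mul1r.
Qed.

(** The unit is a positive 1 by 1 matrix, being 1^* 1. *)
Lemma cp_pos1 F : cp F -> bop_pos (F 1).
Proof.
move=> [_ pF] x; have M0 : cstarmx_pos (1%:M : 'M[A]_1).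
  exists 1%:M; rewrite mulmx1; apply/matrixP => i j.
  by rewrite !ord1 !mxE star1.
by have := pF 1%N 1%:M M0 (fun=> x); rewrite !big_ord1 !mxE.
Qed.

End CompletelyPositive.

(** * Complements of dominated maps and the equivalence *)

Section Main.
Context {R : realType} {A : cstarAlgType R} {H : hilbertType R}.
Implicit Types (P : 'B(H)) (Phi Psi : A -> 'B(H)).

(** Normalises a map whose value at the unit is congruent to [P], so that it may enter a convex
    combination. *)
Lemma CP_Ad_inv P Phi T T' : cp Phi -> Phi 1 = Ad T P -> T * T' = 1 ->
  CP P (Ad T' \o Phi).
Proof.
move=> cpPhi Phi1 TT'; split; first exact: cp_Ad.
by rewrite /= Phi1 AdM TT' Ad1.
Qed.

(** The map is (Phi - Psi) + (3/4) Psi, hence completely positive. With Q its value at the unit, 0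
    <= Psi(1) <= P yields Q <= P <= 4 Q, as [pos_congruence] requires. *)
Lemma complement_cp P Phi Psi B : bop_pos P -> CP P Phi -> cp Psi ->
  le_cp Psi Phi -> Psi 1 = Ad B P ->
  let Psi' := fun a => Phi a - (4^-1 : R)%:C *: Psi a in
  cp Psi' /\ exists C, bop_invertible C /\ Psi' 1 = Ad C P.
Proof.
move=> P0 [cpPhi Phi1] cpPsi lePsi Psi1 Psi'.
have cpPsi' : cp Psi'.
  have -> : Psi' = fun a => (Phi a - Psi a) + (3 / 4 : R)%:C *: Psi a.
    apply/funext => a; rewrite /Psi' -addrA; congr (_ + _).
    rewrite -[- Psi a]scaleN1r -scalerDl -scaleNr; congr (_ *: _).
    by apply/eqP; rewrite eq_complex/= oppr0 addr0 eqxx andbT; apply/eqP; field.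
  by apply: cp_add => //; apply: cp_scale => //; lra.
split=> //.
have Psi1_0 x := bop_pos_rinner x (cp_pos1 cpPsi).
have D0 x := bop_pos_rinner x (cp_pos1 lePsi).
have [||C [Cinv CQ]] := pos_congruence P0 (cp_pos1 cpPsi').
- move=> x; rewrite /Psi' !bopE Phi1 rinnerBl rinnerZl; have := Psi1_0 x; lra.
- move=> x; rewrite /Psi' !bopE Phi1 rinnerBl rinnerZl.
  by have := Psi1_0 x; have := D0 x; rewrite !bopE rinnerBl Phi1 !expr2; lra.
by exists C.
Qed.

End Main.

Theorem theorem3p12 (R : realType) (A : cstarAlgType R) (H : hilbertType R)
    (P : 'B(H)) (hP : bop_pos P) (Phi : A -> 'B(H)) (hPhi : CP P Phi) :
  Cstar_extreme P Phi <->
  (forall Psi : A -> 'B(H), cp Psi -> le_cp Psi Phi ->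
     (exists B : 'B(H), bop_invertible B /\ Psi 1 = adj B * P * B) ->
     exists Z : 'B(H), bop_invertible Z /\ Psi = Ad Z \o Phi).
Proof.
split=> [[_ extr] Psi cpPsi lePsi [B [Binv Psi1]]|dom].
  have [cpPsi' [C [Cinv Psi'1]]] := complement_cp hP hPhi cpPsi lePsi Psi1.
  set Psi' := (X in cp X) in cpPsi' Psi'1.
  have [B' [B'B BB']] := Binv; have [C' [C'C CC']] := Cinv.
  (* The factor 1/2 on [B] turns the first term into Psi/4, which [Psi'] completes to [Phi]. *)
  pose T (j : 'I_2) := if j == 0 then (2^-1 : R)%:C *: B else C.
  pose F (j : 'I_2) := if j == 0 then Ad B' \o Psi else Ad C' \o Psi'.
  have half2 : (2^-1 : R) ^+ 2 = 4^-1 by field.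
  have [|j|j||| S SP] := extr 2 T F.
  - by [].
  - by rewrite /F; case: ifP => _; [exact: (CP_Ad_inv cpPsi Psi1)|
      exact: (CP_Ad_inv cpPsi' Psi'1)].
  - rewrite /T; case: ifP => _ //.
    by apply: bop_invertible_scale; rewrite ?invr_eq0 ?pnatr_eq0.
  - rewrite !big_ord_recl big_ord0 addr0 -![adj _ * _ * _]/(Ad _ _).
    rewrite /T/= Ad_scale half2 -[Ad B P]Psi1 -Psi'1 /Psi' addrC subrK.
    by case: hPhi.
  - apply/funext => a; rewrite !big_ord_recl big_ord0 addr0 /T /F/=.
    by rewrite Ad_scale half2 !AdM B'B C'C !Ad1 /Psi' addrC subrK.
  (* Extremality gives Ad_{B'} Psi = Ad_{S 0} Phi; applying Ad_B leaves Psi on the left. *)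
  have [Sinv SE] := SP 0; exists (S 0 * B); split.
    exact: bop_invertibleM.
  apply/funext => a /=; rewrite -AdM.
  have /(congr1 (fun G => Ad B (G a))) := SE.
  by rewrite /F/= AdM B'B Ad1.
split=> // n T F n1 FCP Tinv TP PhiE.
have /choice[S SP] j : exists S, bop_invertible S /\ F j = Ad S \o Phi.
  have [cpF F1] := FCP j; have [T' [T'T TT']] := Tinv j.
  have [|||Z [Zinv ZE]] := dom (Ad (T j) \o F j).
  - exact: cp_Ad.
  (* Subtracting the j-th term from [Phi] leaves the sum of the others. *)
  - rewrite /le_cp PhiE.
    rewrite (_ : (fun a => _) = fun a => \sum_(k | k != j) Ad (T k) (F k a)).
      apply: (cp_sum (F := fun k => Ad (T k) \o F k)) => k _.
      by apply: cp_Ad; case: (FCP k).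
    by apply/funext => a; rewrite (bigD1 j)//= addrAC subrr add0r.
  - by exists (T j); split=> //; rewrite /= F1.
  (* Conjugating Ad_{T j} F_j = Ad_Z Phi by the inverse [T'] isolates F_j. *)
  exists (Z * T'); split.
    by apply: bop_invertibleM => //; exists (T j).
  apply/funext => a /=; rewrite -AdM.
  have /(congr1 (fun G => Ad T' (G a))) := ZE.
  by rewrite /= AdM TT' Ad1.
by exists S.
Qed.
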